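(* Let $(G,f)$ be an edge-colored directed graph with $C^*(G,f)=\ast_P\,C^*(G_i)$, where each $G_i$ is a $1$-colored directed graph. Let $\{A_i\}$ be a collection of $C^*$-algebras with a common subalgebra $D$. If for each $i$ the map $\pi_i:C^*(G_i)\to A_i$ is a $*$-isomorphism with $\pi_i(P)\subseteq D$, and $\pi_i|_P=\pi_j|_P$ for all $i,j$, then the induced representation $$\ast\,\pi_i:\ C^*(G,f)\to \ast_{\pi_i(P)}\ \pi_i(C^*(G_i))$$ is an isomorphism.
   Context: A directed graph $G=(V,E,r,s)$ has vertex set $V$, edge set $E$, and range and source maps $r,s:E\to V$. An edge-colored directed graph $(G,f)$ is a directed graph $G$ with a function $f:E\to\mathbb{N}=\{1,2,\dots\}$. A Cuntz-Krieger family for a directed graph consists of pairwise orthogonal projections $\{P_v\}_{v\in V}$ and partial isometries $\{S_e\}_{e\in E}$ with pairwise orthogonal ranges such that $S_e^*S_e=P_{s(e)}$, $S_eS_e^*\le P_{r(e)}$, and $P_v=\sum_{r(e)=v}S_eS_e^*$ whenever $r^{-1}(v)$ is finite and nonempty; $C^*(G)$ is the universal $C^*$-algebra generated by such a family. $C^*(G,f)$ is the universal $C^*$-algebra generated by projections $\{P_v\}_{v\in V}$ and partial isometries $\{S_e\}_{e\in E}$ such that for every color $n$, $\{P_v\}_{v\in V}$ together with $\{S_e:f(e)=n\}$ is a Cuntz-Krieger family for $(V,f^{-1}(n),r,s)$. Here $G_i=(V,f^{-1}(i),r,s)$, and $P$ is the $C^*$-algebra generated by the vertex projections, viewed as a common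 subalgebra of all the $C^*(G_i)$. $\ast_P$ denotes the universal free product of $C^*$-algebras amalgamated over $P$; since the $\pi_i$ agree on $P$, the algebra $\pi_i(P)$ is independent of $i$. The induced representation $\ast\,\pi_i$ is the one that restricts to $\pi_i$ on each $C^*(G_i)$. *)

(* Defs.v *)
From HB Require Import structures.
From mathcomp Require Import all_boot all_order all_algebra complex.
From mathcomp Require Import all_classical all_reals all_analysis.

Set Implicit Arguments.
Unset Strict Implicit.
Unset Printing Implicit Defensive.

Import Order.TTheory GRing.Theory Num.Theory.
Import numFieldNormedType.Exports.
Local Open Scope classical_set_scope.
Local Open Scope ring_scope.

(* C*-algebras are complex and not assumed to be unital: C*(G) has a unit only
   when G has finitely many vertices. The multiplication is therefore not that
   of a (necessarily unital) ring structure. *)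
HB.mixin Record isCStarAlgebra (R : realType) A
    of CompleteNormedModule R[i] A := {
  cmul : A -> A -> A;
  star : A -> A;
  cmulA : forall x y z, cmul x (cmul y z) = cmul (cmul x y) z;
  cmulDl : forall x y z, cmul (x + y) z = cmul x z + cmul y z;
  cmulDr : forall x y z, cmul x (y + z) = cmul x y + cmul x z;
  cmulZl : forall (a : R[i]) x y, cmul (a *: x) y = a *: cmul x y;
  cmulZr : forall (a : R[i]) x y, cmul x (a *: y) = a *: cmul x y;
  starK : forall x, star (star x) = x;
  starD : forall x y, star (x + y) = star x + star y;
  starZ : forall (a : R[i]) x, star (a *: x) = a^* *: star x;
  starM : forall x y, star (cmul x y) = cmul (star y) (star x);
  norm_cmul : forall x y, `|cmul x y| <= `|x| * `|y|;
  norm_cstar : forall x, `|cmul (star x) x| = `|x| ^+ 2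
}.

#[short(type="cstarAlgType")]
HB.structure Definition CStarAlgebra (R : realType) :=
  {A of CompleteNormedModule R[i] A & isCStarAlgebra R A}.

Section Algebra.
Variable R : realType.
Implicit Types A B : cstarAlgType R.

(* No boundedness is required: *-homomorphisms between C*-algebras are
   automatically contractive. *)
Record starHom A B := StarHom {
  hom_fun :> {linear A -> B};
  homM : forall x y, hom_fun (cmul x y) = cmul (hom_fun x) (hom_fun y);
  hom_star : forall x, hom_fun (star x) = star (hom_fun x)
}.

(* A C*-subalgebra of A, presented as a C*-algebra with an injective
   *-homomorphism into A; as a set it is [range (sub_incl S)]. The range of a
   *-homomorphism of C*-algebras is always norm closed. *)
Record cstarSub A := CstarSub {
  sub_alg :> cstarAlgType R;
  sub_incl : starHom sub_alg A;
  sub_incl_inj : injective sub_incl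
}.

Definition closed_star_subalgebra A (S : set A) : Prop :=
  [/\ closed S, S 0,
      forall x y, S x -> S y -> S (x + y) /\ S (cmul x y),
      forall (a : R[i]) x, S x -> S (a *: x)
    & forall x, S x -> S (star x)].

Definition generates A (X : set A) : Prop :=
  smallest (@closed_star_subalgebra A) X = setT.

Definition projection A (p : A) : Prop := star p = p /\ cmul p p = p.

Definition partial_isometry A (s : A) : Prop := cmul s (cmul (star s) s) = s.

(* The order of the C*-algebra: positive elements are those of the form c^* c. *)
Definition cstar_le A (a b : A) : Prop :=
  exists c : A, b - a = cmul (star c) c.

End Algebra.
Arguments generates {R A} X.
Arguments projection {R A} p.
Arguments partial_isometry {R A} s.
Arguments cstar_le {R A} a b.

(* [choiceType] is no restriction: classically every type carries such a
   structure. *)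
Record digraph := Digraph {
  vert : choiceType;
  edge : choiceType;
  rng : edge -> vert;
  src : edge -> vert
}.

Definition color := {n : nat | (0 < n)%N}.

Definition color_graph (G : digraph) (f : edge G -> color) (i : color) :
    digraph :=
  @Digraph (vert G) {e : edge G | f e == i}
    (fun e => rng (val e)) (fun e => src (val e)).

Section UniversalAlgebras.
Variable R : realType.

Definition cuntz_krieger (G : digraph) (A : cstarAlgType R)
    (P : vert G -> A) (S : edge G -> A) : Prop :=
  [/\ (forall v, projection (P v)) /\
      (forall v w, v <> w -> cmul (P v) (P w) = 0),
      (forall e, partial_isometry (S e)) /\
      (forall e e', e <> e' ->
        cmul (cmul (S e) (star (S e))) (cmul (S e') (star (S e'))) = 0),
      forall e, cmul (star (S e)) (S e) = P (src e),
      forall e, cstar_le (cmul (S e) (star (S e))) (P (rng e))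
    & forall v, finite_set [set e | rng e = v] -> [set e | rng e = v] !=set0 ->
        P v = \sum_(e \in [set e | rng e = v]) cmul (S e) (star (S e))].

Definition colored_cuntz_krieger (G : digraph) (f : edge G -> color)
    (A : cstarAlgType R) (P : vert G -> A) (S : edge G -> A) : Prop :=
  forall n : color,
    @cuntz_krieger (color_graph f n) A P (fun e => S (val e)).

(* (A, P, S) is the universal C*-algebra generated by a family (P, S) indexed
   by V and E and satisfying [rel]; universal algebras are characterised up to
   isomorphism, by their universal property. *)
Definition universal_family (V E : Type)
    (rel : forall A : cstarAlgType R, (V -> A) -> (E -> A) -> Prop)
    (A : cstarAlgType R) (P : V -> A) (S : E -> A) : Prop :=
  [/\ rel A P S,
      generates (range P `|` range S)
    & forall (B : cstarAlgType R) (Q : V -> B) (T : E -> B), rel B Q T ->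
        exists phi : starHom A B,
          [/\ forall v, phi (P v) = Q v, forall e, phi (S e) = T e
            & forall psi : starHom A B, (forall v, psi (P v) = Q v) ->
                (forall e, psi (S e) = T e) -> psi =1 phi]].

Definition is_graph_cstar (G : digraph) (C : cstarAlgType R)
    (P : vert G -> C) (S : edge G -> C) : Prop :=
  universal_family (@cuntz_krieger G) P S.

Definition is_colored_graph_cstar (G : digraph) (f : edge G -> color)
    (C : cstarAlgType R) (P : vert G -> C) (S : edge G -> C) : Prop :=
  universal_family (@colored_cuntz_krieger G f) P S.

(* F with the maps j_i : A_i -> F is the universal free product of the A_i
   amalgamated over D, along the embeddings alpha_i : D -> A_i. *)
Definition is_amalgamated_free_product (I : Type) (A : I -> cstarAlgType R)
    (D : cstarAlgType R) (alpha : forall i, starHom D (A i))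
    (F : cstarAlgType R) (j : forall i, starHom (A i) F) : Prop :=
  [/\ forall i, injective (alpha i),
      forall i k d, j i (alpha i d) = j k (alpha k d)
    & forall (B : cstarAlgType R) (phi : forall i, starHom (A i) B),
        (forall i k d, phi i (alpha i d) = phi k (alpha k d)) ->
        exists Phi : starHom F B,
          (forall i a, Phi (j i a) = phi i a) /\
          (forall Psi : starHom F B,
            (forall i a, Psi (j i a) = phi i a) -> Psi =1 Phi)].

End UniversalAlgebras.

(* Main.v *)
Require Import Defs.
From HB Require Import structures.
From mathcomp Require Import all_boot all_order all_algebra complex.
From mathcomp Require Import all_classical all_reals all_analysis.

Set Implicit Arguments.
Unset Strict Implicit.
Unset Printing Implicit Defensive.

Local Open Scope classical_set_scope.
Local Open Scope ring_scope.

Import GRing.Theory.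

(** The amalgamated free product depends only on the diagram of embeddings
    D -> A_i up to isomorphism, because it is characterised by a universal
    property; the theorem is an instance of this.

    Corestricting pi_i to its image gives a *-isomorphism
    rho_i : C*(G_i) -> pi_i(C*(G_i)), with inverse sigma_i; both are obtained
    from [starHom_lift], which factors a *-homomorphism through an injective
    one whose range is large enough. The hypothesis that the pi_i agree on P
    says that the rho_i carry the copies of an element of P in the various
    C*(G_i) to the copies of one single element of pi_i(P), and symmetrically
    for the sigma_i. Hence the rho_i and the sigma_i induce *-homomorphisms
    between the two free products ([free_product_map]), in opposite
    directions. Both composites fix the images of the factors, so the
    uniqueness part of the universal properties makes them identities
    ([free_product_iso]). *)

Section StarHomConstructions.
Variable R : realType.
Implicit Types A B C X Y Z : cstarAlgType R.

Lemma starHom_of_fun A B (h : A -> B) :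
    linear h -> (forall x y, h (cmul x y) = cmul (h x) (h y)) ->
    (forall x, h (star x) = star (h x)) ->
  exists H : starHom A B, H =1 h.
Proof.
move=> h_lin hM h_star.
pose h_isLin := GRing.isLinear.Build R[i] A B *:%R h h_lin.
pose hL : {linear A -> B} := HB.pack h h_isLin.
by exists (@StarHom R A B hL hM h_star).
Qed.

Lemma starHom_id A : exists H : starHom A A, H =1 id.
Proof. exact: (@starHom_of_fun A A id). Qed.

Lemma starHom_comp A B C (g : starHom B C) (h : starHom A B) :
  exists H : starHom A C, H =1 g \o h.
Proof.
apply: starHom_of_fun => [a x y|x y|x] /=; first by rewrite !linearP.
- by rewrite !homM.
- by rewrite !hom_star.
Qed.

(** The pointwise preimages are unique since [g] is injective, so they inherit
    all the algebraic identities satisfied by [h]. *)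
Lemma starHom_lift X Y Z (g : starHom Y Z) (h : starHom X Z) :
    injective g -> range h `<=` range g ->
  exists H : starHom X Y, forall x, g (H x) = h x.
Proof.
move=> g_inj h_sub_g.
have [k gk] : {k : X -> Y & forall x, g (k x) = h x}.
  apply: (@choice _ _ (fun x y => g y = h x)) => x.
  by have [|y _ gy] := h_sub_g (h x); [exists x | exists y].
have [|||H Hk] := @starHom_of_fun X Y k.
- by move=> a x y; apply: g_inj; rewrite linearP !gk linearP.
- by move=> x y; apply: g_inj; rewrite homM !gk homM.
- by move=> x; apply: g_inj; rewrite hom_star !gk hom_star.
by exists H => x; rewrite Hk.
Qed.

End StarHomConstructions.

Section FreeProductFunctoriality.
Variables (R : realType) (I : Type).

(** Since [d'] does not depend on [i], the maps [j' i \o rho i] agree on D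
    whenever the [j' i] agree on D'. Compatibility is asked elementwise, so
    that it can be checked inside the factors without first building a
    *-homomorphism D -> D'. *)
Lemma free_product_map
    (A A' : I -> cstarAlgType R) (D D' : cstarAlgType R)
    (alpha : forall i, starHom D (A i)) (alpha' : forall i, starHom D' (A' i))
    (F F' : cstarAlgType R)
    (j : forall i, starHom (A i) F) (j' : forall i, starHom (A' i) F')
    (rho : forall i, starHom (A i) (A' i)) :
    is_amalgamated_free_product alpha j ->
    is_amalgamated_free_product alpha' j' ->
    (forall d, exists d', forall i, rho i (alpha i d) = alpha' i d') ->
  exists Phi : starHom F F', forall i a, Phi (j i a) = j' i (rho i a).
Proof.
move=> [_ _ F_univ] [_ j'_agree _] rho_D.
have phi i := cid (starHom_comp (j' i) (rho i)).
have [|Phi [PhiE _]] := F_univ F' (fun i => sval (phi i)); last first.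
  by exists Phi => i a; rewrite PhiE (svalP (phi i)).
move=> i k d; have [d' rho_d] := rho_D d.
by rewrite (svalP (phi i)) (svalP (phi k)) /= !rho_d (j'_agree i k).
Qed.

(** Both homomorphisms are extensions of the same compatible family
    [Psi \o j i], and the universal property allows only one extension. *)
Lemma free_product_hom_ext
    (A : I -> cstarAlgType R) (D : cstarAlgType R)
    (alpha : forall i, starHom D (A i)) (F : cstarAlgType R)
    (j : forall i, starHom (A i) F) (B : cstarAlgType R)
    (Phi Psi : starHom F B) :
    is_amalgamated_free_product alpha j ->
    (forall i a, Phi (j i a) = Psi (j i a)) ->
  Phi =1 Psi.
Proof.
move=> [_ j_agree F_univ] PhiPsi.
have phi i := cid (starHom_comp Psi (j i)).
have [|Theta [_ Theta_uniq]] := F_univ B (fun i => sval (phi i)).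
  by move=> i k d; rewrite (svalP (phi i)) (svalP (phi k)) /= (j_agree i k).
move=> x; rewrite (Theta_uniq Phi) ?(Theta_uniq Psi) // => i a;
  by rewrite (svalP (phi i)).
Qed.

(** The inverse of [Phi] is the map induced by the [sigma i]: each composite
    agrees on the factors with the identity, hence equals it by
    [free_product_hom_ext]. *)
Lemma free_product_iso
    (A A' : I -> cstarAlgType R) (D D' : cstarAlgType R)
    (alpha : forall i, starHom D (A i)) (alpha' : forall i, starHom D' (A' i))
    (F F' : cstarAlgType R)
    (j : forall i, starHom (A i) F) (j' : forall i, starHom (A' i) F')
    (rho : forall i, starHom (A i) (A' i))
    (sigma : forall i, starHom (A' i) (A i)) :
    is_amalgamated_free_product alpha j ->
    is_amalgamated_free_product alpha' j' ->
    (forall i, cancel (rho i) (sigma i)) ->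
    (forall i, cancel (sigma i) (rho i)) ->
    (forall d, exists d', forall i, rho i (alpha i d) = alpha' i d') ->
    (forall d', exists d, forall i, sigma i (alpha' i d') = alpha i d) ->
  exists2 Phi : starHom F F',
    forall i a, Phi (j i a) = j' i (rho i a) & bijective Phi.
Proof.
move=> F_free F'_free rhoK sigmaK rho_D sigma_D.
have [Phi PhiE] := free_product_map F_free F'_free rho_D.
have [Psi PsiE] := free_product_map F'_free F_free sigma_D.
exists Phi => //; exists Psi => x.
- have [H HE] := starHom_comp Psi Phi; have [E EE] := starHom_id F.
  rewrite -[LHS]HE -[RHS]EE; apply: (free_product_hom_ext F_free) => i a.
  by rewrite HE EE /= PhiE PsiE rhoK.
- have [H HE] := starHom_comp Phi Psi; have [E EE] := starHom_id F'.
  rewrite -[LHS]HE -[RHS]EE; apply: (free_product_hom_ext F'_free) => i a.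
  by rewrite HE EE /= PsiE PhiE sigmaK.
Qed.

End FreeProductFunctoriality.

Theorem theorem3 (R : realType)
  (G : digraph) (f : edge G -> color)
  (* C*(G, f) *)
  (C : cstarAlgType R) (Pv : vert G -> C) (Se : edge G -> C)
  (C_univ : is_colored_graph_cstar f Pv Se)
  (* the algebras C*(G_i) *)
  (CG : color -> cstarAlgType R)
  (PG : forall i, vert G -> CG i)
  (SG : forall i, edge (color_graph f i) -> CG i)
  (CG_univ : forall i, @is_graph_cstar R (color_graph f i) (CG i) (PG i) (SG i))
  (* P, as a common subalgebra of the C*(G_i) *)
  (P : cstarAlgType R) (p : vert G -> P) (P_gen : generates (range p))
  (kappa : forall i, starHom P (CG i))
  (kappa_inj : forall i, injective (kappa i))
  (kappa_p : forall i v, kappa i (p v) = PG i v)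
  (* C*(G, f) is the free product of the C*(G_i) amalgamated over P, along
     the canonical maps *)
  (j : forall i, starHom (CG i) C)
  (j_P : forall i v, j i (PG i v) = Pv v)
  (j_S : forall i e, j i (SG i e) = Se (val e))
  (C_free : is_amalgamated_free_product kappa j)
  (* the A_i, with their common subalgebra D *)
  (A : color -> cstarAlgType R)
  (D : cstarAlgType R) (iota : forall i, starHom D (A i))
  (iota_inj : forall i, injective (iota i))
  (* the *-isomorphisms pi_i, onto their images pi_i(C*(G_i)) in A_i, with
     pi_i(P) contained in D, and agreeing on P *)
  (pi : forall i, starHom (CG i) (A i))
  (pi_iso : forall i, injective (pi i))
  (pi_P : forall i x, exists d, pi i (kappa i x) = iota i d)
  (pi_agree : forall i k x d,
     pi i (kappa i x) = iota i d -> pi k (kappa k x) = iota k d)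
  (* the subalgebras pi_i(C*(G_i)) of A_i and pi_i(P) of D, and the inclusions
     of the latter into the former *)
  (piC : forall i, cstarSub (A i))
  (piCE : forall i, range (sub_incl (piC i)) = range (pi i))
  (piP : cstarSub D)
  (piPE : forall i, iota i @` range (sub_incl piP) = range (pi i \o kappa i))
  (lambda : forall i, starHom piP (piC i))
  (lambdaE : forall i x,
     sub_incl (piC i) (lambda i x) = iota i (sub_incl piP x))
  (* their amalgamated free product *)
  (F : cstarAlgType R) (m : forall i, starHom (piC i) F)
  (F_free : is_amalgamated_free_product lambda m) :
  let induced (Phi : starHom C F) :=
    forall i x (y : piC i), sub_incl (piC i) y = pi i x -> Phi (j i x) = m i y in
  exists Phi : starHom C F,
    [/\ induced Phi,
        forall Psi : starHom C F, induced Psi -> Psi =1 Phi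
      & bijective Phi].
Proof.
move=> induced.
have incl_inj i := @sub_incl_inj R (A i) (piC i).
have rho_ i : {r : starHom (CG i) (piC i) | forall x, sub_incl _ (r x) = pi i x}.
  by apply: cid; apply: starHom_lift => //; rewrite piCE.
have sigma_ i : {s : starHom (piC i) (CG i) | forall y, pi i (s y) = sub_incl _ y}.
  by apply: cid; apply: starHom_lift => //; rewrite piCE.
pose rho i := sval (rho_ i); pose sigma i := sval (sigma_ i).
have rhoE i x : sub_incl _ (rho i x) = pi i x := svalP (rho_ i) x.
have sigmaE i y : pi i (sigma i y) = sub_incl _ y := svalP (sigma_ i) y.
have rhoK i : cancel (rho i) (sigma i).
  by move=> x; apply: pi_iso; rewrite sigmaE rhoE.
have sigmaK i : cancel (sigma i) (rho i).
  by move=> y; apply: incl_inj; rewrite rhoE sigmaE.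
(* The matching of P with piP is read off at one color, and [pi_agree]
   transports it to all the others. *)
pose i0 : color := exist _ 1%N isT.
have rho_P d : exists e, forall i, rho i (kappa i d) = lambda i e.
  have : (iota i0 @` range (sub_incl piP)) (pi i0 (kappa i0 d)).
    by rewrite piPE; exists d.
  case=> _ [e _ <-] iota_e; exists e => i.
  by apply: incl_inj; rewrite rhoE lambdaE; apply: (pi_agree i0).
have sigma_P e : exists d, forall i, sigma i (lambda i e) = kappa i d.
  have : range (pi i0 \o kappa i0) (iota i0 (sub_incl piP e)).
    by rewrite -piPE; exists (sub_incl piP e) => //; exists e.
  case=> d _ /= pi_d; exists d => i.
  by apply: pi_iso; rewrite sigmaE lambdaE; apply/esym/(pi_agree i0).
have [Phi PhiE Phi_bij] :=
  free_product_iso C_free F_free rhoK sigmaK rho_P sigma_P.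
exists Phi; split=> //.
- move=> i x y y_pi; rewrite PhiE; congr (m i _).
  by apply: incl_inj; rewrite rhoE.
- move=> Psi Psi_ind; apply: (free_product_hom_ext C_free) => i x.
  by rewrite PhiE; apply: Psi_ind; rewrite rhoE.
Qed.
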